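(* Let $a>0$, let $\mathcal A\in M_N(\mathbb C)$ be an invertible constant matrix, let $W(0)\in M_N(\mathbb C)$ be positive definite, and let $$W(x)=\frac{a^x}{x!}\mathcal A^xW(0)(\mathcal A^* )^x,\qquad x\in\mathbb N_0.$$ Then the square norms $\mathcal H_n$ of the monic orthogonal polynomials with respect to $W$ satisfy, for all $n\ge2$, $$\mathcal H_n=a^2\mathcal A^2\mathcal H_{n-1}(\mathcal A^* )^2-a^2\mathcal A\mathcal H_{n-1}\mathcal A^*\mathcal H_{n-1}^{-1}\mathcal A\mathcal H_{n-1}\mathcal A^*+a\mathcal A\mathcal H_{n-1}\mathcal A^*+\mathcal A\mathcal H_{n-1}(\mathcal A^* )^{-1}\mathcal H_{n-2}^{-1}\mathcal A^{-1}\mathcal H_{n-1}\mathcal A^*,$$ and $$\mathcal H_1=a^2\mathcal A^2\mathcal H_0(\mathcal A^* )^2-a^2\mathcal A\mathcal H_0\mathcal A^*\mathcal H_0^{-1}\mathcal A\mathcal H_0\mathcal A^*+a\mathcal A\mathcal H_0\mathcal A^*.$$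
   Context: $\mathbb N_0=\{0,1,2,\dots\}$; $*$ is conjugate transpose. With $\langle P,Q\rangle=\sum_{x=0}^\infty P(x)W(x)Q(x)^*$ on $N\times N$ matrix polynomials, the monic orthogonal polynomials $(P_n)_n$ are the unique matrix polynomials with leading coefficient the identity, $\deg P_n=n$ and $\langle P_m,P_n\rangle=\mathcal H_m\delta_{m,n}$ with $\mathcal H_m$ positive definite (the square norm). *)

(* Defs.v *)
From HB Require Import structures.
From mathcomp Require Import all_boot all_order all_algebra.
From mathcomp Require Import complex.
From mathcomp Require Import boolp classical_sets reals topology normedtype.
From mathcomp Require Import sequences.

Set Implicit Arguments.
Unset Strict Implicit.
Unset Printing Implicit Defensive.

Import Order.TTheory GRing.Theory Num.Theory.
Import numFieldNormedType.Exports.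

Local Open Scope classical_set_scope.
Local Open Scope sesquilinear_scope.
Local Open Scope ring_scope.

(* The definitions are stated over an abstract numClosedFieldType K because
   numFieldNormedType attaches the norm topology to abstract fields and not to
   the type R[i] itself; they are meant to be used with K := R[i]. *)

Definition posdefmx (K : numClosedFieldType) (n : nat) (M : 'M[K]_n) : Prop :=
  M \is hermsymmx /\
  forall v : 'cV[K]_n, v != 0 -> 0 < (v ^t* *m M *m v) ord0 ord0.

(* Matrix polynomials have N x N coefficients and the argument x is evaluated
   as the central element x%:R, that is, x times the identity.  The limit is
   taken in the norm topology of 'M[K]_N.+1. *)
Definition mxip (K : numClosedFieldType) (N : nat) (W : nat -> 'M[K]_N.+1)
    (P Q : {poly 'M[K]_N.+1}) : 'M[K]_N.+1 :=
  limn (series (fun x : nat => P.[x%:R] * W x * (Q.[x%:R]) ^t*)).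

Definition monic_orthogonal (K : numClosedFieldType) (N : nat)
    (W : nat -> 'M[K]_N.+1) (P : nat -> {poly 'M[K]_N.+1})
    (H : nat -> 'M[K]_N.+1) : Prop :=
  [/\ forall n, P n \is monic /\ size (P n) = n.+1,
      forall m n, mxip W (P m) (P n) = if m == n then H m else 0
    & forall n, posdefmx (H n)].

(* Main.v *)
Require Import Defs.
From HB Require Import structures.
From mathcomp Require Import all_boot all_order all_algebra.
From mathcomp Require Import complex reals.
From mathcomp Require Import boolp classical_sets topology normedtype.
From mathcomp Require Import sequences.

Set Implicit Arguments.
Unset Strict Implicit.
Unset Printing Implicit Defensive.

Import Order.TTheory GRing.Theory Num.Theory.
Import numFieldNormedType.Exports.

Local Open Scope classical_set_scope.
Local Open Scope sesquilinear_scope.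
Local Open Scope complex_scope.
Local Open Scope ring_scope.

(** The weight satisfies (x + 1) W(x + 1) = a A W(x) A^*.  Moving the factor
    x + 1 from one argument of the inner product to the other and reindexing
    the sum turns this identity into an adjunction
      <P, U Q> = a <T P, Q>
    between T P = P(x + 1) A and U P = x P(x - 1) A^-1 ([lower], [raise],
    [mxip_ladder_form]).  T keeps the degree and multiplies the
    leading coefficient by A; U raises the degree by one and multiplies the
    leading coefficient by A^-1.  As P_n is orthogonal to every polynomial of
    smaller degree, the adjunction leaves only two terms in each expansion:
      T P_n = A P_n + a^-1 H_n A^-* H_(n-1)^-1 P_(n-1),
      U P_n = A^-1 P_(n+1) + a H_n A^* H_n^-1 P_n,
    and Parseval's identity gives the square norms
      <T P_n, T P_n> = A H_n A^* + a^-2 H_n A^-* H_(n-1)^-1 A^-1 H_n,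
      <U P_n, U P_n> = A^-1 H_(n+1) A^-* + a^2 H_n A^* H_n^-1 A H_n
    ([norm_lowerS], [norm_raise]).  On the other hand U T is multiplication by
    x and T U is multiplication by x + 1, so that the adjunction, used twice,
    yields ([norm_raise_lower])
      <U P_n, U P_n> = a <(x + 1) P_n, P_n> = a (a <T P_n, T P_n> + H_n).
    Comparing the two values of <U P_n, U P_n> and solving for H_(n+1) is the
    claimed recursion; for n = 0 the expansion of T P_0 has no second term,
    which is why the formula for H_1 lacks the last summand.

    The inner product is a limit, so additivity, hermitian symmetry and
    reindexing all require the series to converge.  It does because
    polynomials and powers of a matrix grow at most exponentially, whereas the
    weight carries the factor 1 / x! ([charlier_summable]). *)

(** * Conjugate transposes and positive definite matrices *)

Lemma ctmxM (K : numClosedFieldType) n (B C : 'M[K]_n.+1) :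
  (B * C) ^t* = C ^t* * B ^t*.
Proof. by rewrite trmx_mul map_mxM. Qed.

Lemma ctmxX (K : numClosedFieldType) n (B : 'M[K]_n.+1) k :
  (B ^+ k) ^t* = (B ^t*) ^+ k.
Proof.
by elim: k => [|k IHk]; rewrite ?expr0 ?trmx1 ?map_mx1// exprS ctmxM IHk -exprSr.
Qed.

Lemma ctmxZ (K : numClosedFieldType) m n (c : K) (B : 'M[K]_(m, n)) :
  (c *: B) ^t* = c^* *: B ^t*.
Proof. by rewrite linearZ map_mxZ. Qed.

Lemma ctmx_unit (K : numClosedFieldType) n (B : 'M[K]_n.+1) :
  (B ^t* \is a GRing.unit) = (B \is a GRing.unit).
Proof. by rewrite -[LHS]/(_ \in unitmx) map_unitmx unitmx_tr. Qed.

Lemma ctmxV (K : numClosedFieldType) n (B : 'M[K]_n.+1) :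
  (B^-1) ^t* = (B ^t*)^-1.
Proof. by rewrite trmx_inv map_invmx. Qed.

Lemma posdefmx_ctmx (K : numClosedFieldType) n (M : 'M[K]_n) :
  posdefmx M -> M ^t* = M.
Proof. by case=> /is_hermitianmxP; rewrite scale1r => <-. Qed.

(** A kernel vector would make the associated quadratic form vanish. *)
Lemma posdefmx_unit (K : numClosedFieldType) n (M : 'M[K]_n) :
  posdefmx M -> M \in unitmx.
Proof.
move=> [_ Mpos]; rewrite -unitmx_tr -row_free_unit -kermx_eq0.
apply/negPn/negP => /rowV0Pn[v /sub_kermxP vM v0].
have := Mpos v^T; rewrite trmx_eq0 => /(_ v0).
by rewrite -mulmxA -(trmxK M) -trmx_mul vM trmx0 mulmx0 mxE ltxx.
Qed.

(** * The ladder operators on matrix polynomials *)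

Definition shift_poly (R : nzRingType) (c : R) (p : {poly R}) : {poly R} :=
  p \Po ('X + c%:P).

Lemma coef_XaddC_exp (R : nzRingType) (c : R) i n :
  (i <= n)%N -> (('X + c%:P) ^+ i)`_n = (i == n)%:R.
Proof.
rewrite -[c]opprK polyCN leq_eqVlt => /predU1P[<-|lt_in].
  have /monicP := monic_exp i (monicXsubC (- c)).
  by rewrite eqxx lead_coefE size_exp_XsubC.
by rewrite nth_default ?size_exp_XsubC// ltn_eqF.
Qed.

(** Stated for every bound n on the degree rather than for the degree itself:
    the case n = deg p preserves the leading coefficient, and larger n show
    that the degree does not grow. *)
Lemma coef_shift_poly (R : nzRingType) (c : R) (p : {poly R}) n :
  (size p <= n.+1)%N -> (shift_poly c p)`_n = p`_n.
Proof.
move=> sp; rewrite coef_comp_poly.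
rewrite (eq_bigr (fun i : 'I_(size p) => if i == n :> nat then p`_i else 0));
  last first.
  move=> i _; rewrite coef_XaddC_exp.
    by case: eqP => _; rewrite ?mulr1 ?mulr0.
  by rewrite -ltnS (leq_trans (ltn_ord i)).
rewrite -big_mkcond; have [lt_np|le_pn] := ltnP n (size p).
  by rewrite (big_pred1 (Ordinal lt_np)).
rewrite nth_default// big_pred0// => i.
by rewrite ltn_eqF// (leq_trans (ltn_ord i)).
Qed.

Lemma size_shift_poly (R : nzRingType) (c : R) (p : {poly R}) :
  (size (shift_poly c p) <= size p)%N.
Proof.
apply/leq_sizeP => j le_pj; rewrite coef_shift_poly ?nth_default//.
exact: leq_trans le_pj _.
Qed.

(** The coefficients do not commute, so substitution followed by evaluation is
    evaluation at y + c only for y commuting with c; the points of interest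
    are integers, which are central. *)
Lemma horner_shift_poly (R : nzRingType) (c y : R) (p : {poly R}) :
  GRing.comm y c -> (shift_poly c p).[y] = p.[y + c].
Proof.
move=> cyc; rewrite /shift_poly comp_polyE horner_sum horner_coef.
have comm_yc : comm_poly ('X + c%:P) y.
  rewrite /comm_poly hornerD hornerX hornerC mulrDl mulrDr.
  by congr (_ + _).
apply: eq_bigr => i _.
by rewrite hornerZ horner_exp_comm// hornerD hornerX hornerC.
Qed.

(** The operator T: P |-> P(x + 1) A.  It lowers in the sense that
    T P_n only involves P_n and P_(n-1). *)
Definition lower (R : unitRingType) (A : R) (p : {poly R}) : {poly R} :=
  shift_poly 1 p * A%:P.

(** The operator U: P |-> x P(x - 1) A^-1, adjoint to [lower] up to the
    factor a. *)
Definition raise (R : unitRingType) (A : R) (p : {poly R}) : {poly R} :=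
  'X * (shift_poly (-1) p * (A^-1)%:P).

Lemma lower_lead (R : unitRingType) (A : R) (p : {poly R}) n :
  (size p <= n.+1)%N ->
  (size (lower A p) <= n.+1)%N /\ (lower A p)`_n = p`_n * A.
Proof.
move=> sp; have sq : (size (lower A p) <= size p)%N.
  apply/leq_sizeP => j le_pj; rewrite coefMC nth_default ?mul0r//.
  exact: leq_trans (size_shift_poly _ _) le_pj.
by split; [exact: leq_trans sq sp|rewrite coefMC coef_shift_poly].
Qed.

Lemma raise_lead (R : unitRingType) (A : R) (p : {poly R}) n :
  (size p <= n.+1)%N ->
  (size (raise A p) <= n.+2)%N /\ (raise A p)`_n.+1 = p`_n * A^-1.
Proof.
move=> sp; split; last by rewrite coefXM coefMC coef_shift_poly.
apply/leq_sizeP => -[//|j]; rewrite ltnS => lt_nj.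
rewrite coefXM coefMC nth_default ?mul0r//.
exact: leq_trans (size_shift_poly _ _) (leq_trans sp lt_nj).
Qed.

Lemma horner_lower (R : unitRingType) (A : R) (p : {poly R}) (y : R) :
  GRing.comm y A -> (lower A p).[y] = p.[y + 1] * A.
Proof.
move=> cyA; rewrite hornerM_comm.
  by rewrite hornerC horner_shift_poly//; exact: commr1.
by rewrite /comm_poly hornerC.
Qed.

Lemma horner_raise (R : unitRingType) (A : R) (p : {poly R}) (y : R) :
  GRing.comm y A -> (raise A p).[y] = p.[y - 1] * A^-1 * y.
Proof.
move=> cyA; rewrite /raise -commr_polyX hornerMX hornerM_comm.
  by rewrite hornerC horner_shift_poly//; apply/commrN/commr1.
by rewrite /comm_poly hornerC; exact: commrV cyA.
Qed.

(** * Matrix inner products with a ladder adjunction *)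

(** The properties of [mxip] for the Charlier-type weight that the algebraic
    argument relies on.  The field [ip_nat] says that the form only sees the
    values at the natural numbers; it allows U T P = x P and T U P = (x + 1) P
    to be checked by evaluation instead of as identities of polynomials. *)
Record ladder_form (K : numClosedFieldType) N (A : 'M[K]_N.+1) (a : K)
  (ip : {poly 'M[K]_N.+1} -> {poly 'M[K]_N.+1} -> 'M[K]_N.+1) : Prop :=
  LadderForm {
    ipD : forall P1 P2 Q, ip (P1 + P2) Q = ip P1 Q + ip P2 Q;
    ipM : forall C P Q, ip (C%:P * P) Q = C * ip P Q;
    ipC : forall P Q, ip Q P = (ip P Q) ^t*;
    ip_nat : forall P1 P2 Q,
      (forall x : nat, P1.[x%:R] = P2.[x%:R]) -> ip P1 Q = ip P2 Q;
    ip_raise : forall P Q, ip P (raise A Q) = a *: ip (lower A P) Q }.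

Record orthogonal_family (K : numClosedFieldType) N
  (ip : {poly 'M[K]_N.+1} -> {poly 'M[K]_N.+1} -> 'M[K]_N.+1)
  (P : nat -> {poly 'M[K]_N.+1}) (H : nat -> 'M[K]_N.+1) : Prop :=
  OrthogonalFamily {
    orth_monic : forall n, P n \is monic;
    orth_size : forall n, size (P n) = n.+1;
    orthE : forall m n, ip (P m) (P n) = if m == n then H m else 0;
    orth_unit : forall n, H n \is a GRing.unit;
    orth_herm : forall n, (H n) ^t* = H n }.

Section Ladder.
Context (K : numClosedFieldType) (N : nat) (A : 'M[K]_N.+1) (a : K).
Context (ip : {poly 'M[K]_N.+1} -> {poly 'M[K]_N.+1} -> 'M[K]_N.+1).
Context (P : nat -> {poly 'M[K]_N.+1}) (H : nat -> 'M[K]_N.+1).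
Context (A_unit : A \is a GRing.unit) (a_neq0 : a != 0) (a_real : a^* = a).
Context (ladder : ladder_form A a ip) (orth : orthogonal_family ip P H).

Lemma ip0l Q : ip 0 Q = 0.
Proof. by have := ipM ladder 0 0 Q; rewrite polyC0 !mul0r. Qed.

(** Division by the monic P_n with constant quotient: one step of the expansion
    of Q in the basis (P_k). *)
Lemma monic_split n (Q : {poly 'M[K]_N.+1}) : (size Q <= n.+1)%N ->
  (size (Q - (Q`_n)%:P * P n)%R <= n)%N.
Proof.
move=> sQ; apply/leq_sizeP => j; rewrite leq_eqVlt coefB coefCM => /predU1P[<-|lt_nj].
  have /monicP := orth_monic orth n; rewrite lead_coefE (orth_size orth) /= => ->.
  by rewrite mulr1 subrr.
rewrite (nth_default _ (leq_trans sQ lt_nj)) [(P n)`_j]nth_default ?mulr0 ?subr0//.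
by rewrite (orth_size orth).
Qed.

(** The family (P_k) for k < n is an orthogonal basis, for left linear
    combinations, of the polynomials of degree less than n.  The factors do not
    commute: the inverse norm has to sit between the two coefficients. *)
Lemma parseval n (Q Q' : {poly 'M[K]_N.+1}) : (size Q <= n)%N ->
  ip Q Q' = \sum_(k < n) ip Q (P k) * (H k)^-1 * ip (P k) Q'.
Proof.
elim: n Q Q' => [|n IHn] Q Q' sQ.
  by rewrite big_ord0; move: sQ; rewrite size_poly_leq0 => /eqP ->; rewrite ip0l.
have sR := monic_split sQ; set R := Q - _ in sR.
have QE B : ip Q B = Q`_n * ip (P n) B + ip R B.
  by rewrite -(ipM ladder) -(ipD ladder) addrC subrK.
rewrite big_ord_recr /= QE.
have orthnk k : (k < n)%N -> ip (P n) (P k) = 0.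
  by move=> lt_kn; rewrite (orthE orth) gtn_eqF.
have orthkn k : (k < n)%N -> ip (P k) (P n) = 0.
  by move=> lt_kn; rewrite (orthE orth) ltn_eqF.
have RPn : ip R (P n) = 0.
  by rewrite (IHn _ _ sR) big1// => k _; rewrite orthkn ?mulr0.
rewrite [ip Q (P n)]QE RPn addr0 (orthE orth) eqxx mulrK ?(orth_unit orth)//.
rewrite addrC; congr (_ + _); rewrite (IHn _ _ sR); apply: eq_bigr => k _.
by rewrite QE orthnk// mulr0 add0r.
Qed.

Lemma ip_low n (Q : {poly 'M[K]_N.+1}) : (size Q <= n)%N -> ip Q (P n) = 0.
Proof.
move=> sQ; rewrite (parseval _ sQ) big1// => k _.
by rewrite (orthE orth) ltn_eqF// mulr0.
Qed.

Lemma ip_lead n (Q : {poly 'M[K]_N.+1}) : (size Q <= n.+1)%N ->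
  ip Q (P n) = Q`_n * H n.
Proof.
move=> sQ; rewrite -[Q](subrK ((Q`_n)%:P * P n)) (ipD ladder) (ipM ladder).
rewrite (ip_low (monic_split sQ)) add0r (orthE orth) eqxx subrK//.
Qed.

Lemma size_orth n : (size (P n) <= n.+1)%N. Proof. by rewrite (orth_size orth). Qed.

Lemma coef_orth n : (P n)`_n = 1.
Proof. by have /monicP := orth_monic orth n; rewrite lead_coefE (orth_size orth). Qed.

Lemma ip_lower_same n : ip (lower A (P n)) (P n) = A * H n.
Proof.
by have [sT cT] := lower_lead A (size_orth n); rewrite ip_lead// cT coef_orth mul1r.
Qed.

Lemma ip_raise_next n : ip (raise A (P n)) (P n.+1) = A^-1 * H n.+1.
Proof.
by have [sT cT] := raise_lead A (size_orth n); rewrite ip_lead// cT coef_orth mul1r.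
Qed.

Lemma ip_raiseE Q Q' : ip (raise A Q) Q' = a *: ip Q (lower A Q').
Proof. by rewrite (ipC ladder) (ip_raise ladder) ctmxZ a_real -(ipC ladder). Qed.

Lemma ip_lowerE Q Q' : ip (lower A Q) Q' = a^-1 *: ip Q (raise A Q').
Proof. by rewrite (ip_raise ladder) scalerA mulVf// scale1r. Qed.

(** By adjunction the coefficient is governed by U P_k, of degree k + 1 < n. *)
Lemma ip_lower_low n k : (k.+1 < n)%N -> ip (lower A (P n)) (P k) = 0.
Proof.
move=> lt_kn; have [sT _] := raise_lead A (size_orth k).
rewrite ip_lowerE (ipC ladder) ip_low ?(leq_trans sT)//.
by rewrite trmx0 map_mx0 scaler0.
Qed.

Lemma ip_lower_prev n : ip (lower A (P n.+1)) (P n) = a^-1 *: (H n.+1 * (A ^t*)^-1).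
Proof.
rewrite ip_lowerE (ipC ladder) ip_raise_next ctmxM ctmxV.
by rewrite (orth_herm orth).
Qed.

(** By adjunction the coefficient is governed by T P_k, of degree k < n. *)
Lemma ip_raise_low n k : (k < n)%N -> ip (raise A (P n)) (P k) = 0.
Proof.
move=> lt_kn; have [sT _] := lower_lead A (size_orth k).
rewrite ip_raiseE (ipC ladder) ip_low ?(leq_trans sT)//.
by rewrite trmx0 map_mx0 scaler0.
Qed.

Lemma ip_raise_same n : ip (raise A (P n)) (P n) = a *: (H n * A ^t*).
Proof.
by rewrite ip_raiseE (ipC ladder) ip_lower_same ctmxM (orth_herm orth).
Qed.

Lemma norm_lower0 : ip (lower A (P 0)) (lower A (P 0)) = A * H 0 * A ^t*.
Proof.
have [sT _] := lower_lead A (size_orth 0).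
rewrite (parseval _ sT) big_ord_recl big_ord0 addr0 /=.
rewrite (ipC ladder (lower _ _)) ip_lower_same ctmxM (orth_herm orth).
by rewrite mulrK ?(orth_unit orth)// mulrA.
Qed.

Lemma norm_lowerS n : ip (lower A (P n.+1)) (lower A (P n.+1)) =
  A * H n.+1 * A ^t* + a^-1 ^+ 2 *:
     (H n.+1 * (A ^t*)^-1 * (H n)^-1 * A^-1 * H n.+1).
Proof.
have [sT _] := lower_lead A (size_orth n.+1).
rewrite (parseval _ sT) !big_ord_recr /= big1; last first.
  by move=> k _; rewrite ip_lower_low ?mul0r// ltnS ltn_ord.
rewrite add0r addrC !(ipC ladder (lower _ _)) ip_lower_same ip_lower_prev.
rewrite ctmxZ !ctmxM !(orth_herm orth) ctmxV trmxCK.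
rewrite mulrK ?(orth_unit orth)// mulrA; congr (_ + _).
by rewrite fmorphV /= a_real -!scalerAl -!scalerAr scalerA !mulrA.
Qed.

Lemma norm_raise n : ip (raise A (P n)) (raise A (P n)) =
  A^-1 * H n.+1 * (A ^t*)^-1 + a ^+ 2 *: (H n * A ^t* * (H n)^-1 * A * H n).
Proof.
have [sT _] := raise_lead A (size_orth n).
rewrite (parseval _ sT) !big_ord_recr /= big1; last first.
  by move=> k _; rewrite ip_raise_low ?mul0r.
rewrite add0r addrC !(ipC ladder (raise _ _)) ip_raise_same ip_raise_next.
rewrite ctmxZ !ctmxM !(orth_herm orth) ctmxV trmxCK.
rewrite mulrK ?(orth_unit orth)// mulrA; congr (_ + _).
by rewrite a_real -!scalerAl -!scalerAr scalerA !mulrA.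
Qed.

Lemma nat_comm (B : 'M[K]_N.+1) x : GRing.comm x%:R B.
Proof. exact/commr_sym/commr_nat. Qed.

(** Multiplication by x is U T, whence its quadratic form is that of T. *)
Lemma ip_mulX Q Q' : ip (Q * 'X) Q' = a *: ip (lower A Q) (lower A Q').
Proof.
rewrite -ip_raiseE; apply: (ip_nat ladder) => x.
rewrite hornerMX horner_raise ?horner_lower ?subrK; try exact: nat_comm.
  by rewrite mulrK.
by apply/commr_sym/commrB; [exact: commr_nat|exact: commr1].
Qed.

(** Here T U is multiplication by x + 1, and x is handled by [ip_mulX].  This
    second value of the norm of U P_n is what closes the recursion. *)
Lemma norm_raise_lower n : ip (raise A (P n)) (raise A (P n)) =
  a *: (a *: ip (lower A (P n)) (lower A (P n)) + H n).
Proof.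
rewrite (ip_raise ladder) -ip_mulX.
have -> : H n = ip (P n) (P n) by rewrite (orthE orth) eqxx.
rewrite -(ipD ladder); congr (_ *: _); apply: (ip_nat ladder) => x.
have comm_x1 : GRing.comm (x%:R + 1) A by rewrite natr1; exact: nat_comm.
rewrite horner_lower ?horner_raise ?addrK//; last exact: nat_comm.
by rewrite -mulrA comm_x1 mulrA mulrVK// hornerD hornerMX mulrDr mulr1.
Qed.

(** Equating the values of the norm of U P_n given by [norm_raise] and
    [norm_raise_lower], and solving for H_(n+1).  The norm of T P_n is kept as
    it is because its value depends on whether n = 0. *)
Lemma normS_recursion n : H n.+1 =
  a ^+ 2 *: (A * ip (lower A (P n)) (lower A (P n)) * A ^t*)
  - a ^+ 2 *: (A * H n * A ^t* * (H n)^-1 * A * H n * A ^t*)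
  + a *: (A * H n * A ^t*).
Proof.
have At_unit : A ^t* \is a GRing.unit by rewrite ctmx_unit.
pose E := ip (lower A (P n)) (lower A (P n)).
have -> : H n.+1 = A * (A^-1 * H n.+1 * (A ^t*)^-1) * A ^t*.
  by rewrite !mulrA mulrV// mul1r mulrVK.
have -> : A^-1 * H n.+1 * (A ^t*)^-1 =
    a *: (a *: E + H n) - a ^+ 2 *: (H n * A ^t* * (H n)^-1 * A * H n).
  by rewrite -norm_raise_lower norm_raise addrK.
rewrite scalerDr scalerA -expr2 mulrBr mulrBl mulrDr mulrDl.
by rewrite -!scalerAr -!scalerAl !mulrA addrAC.
Qed.

End Ladder.

(** * Sequences of matrices of at most exponential growth *)

(** This class is closed under sums, products
    and conjugate transposes, which is all that is needed to bound the terms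
    of the inner product without computing them. *)
Definition exp_bounded (K : numFieldType) m n (u : nat -> 'M[K]_(m, n)) : Prop :=
  exists C c, [/\ 0 <= C, 0 <= c & forall x i j, `|u x i j| <= C * c ^+ x].

Lemma exp_bounded_cst (K : numFieldType) m n (B : 'M[K]_(m, n)) :
  exp_bounded (fun=> B).
Proof.
exists (\sum_i \sum_j `|B i j|), 1; split=> // [|x i j].
  by apply: sumr_ge0 => i _; apply: sumr_ge0.
rewrite expr1n mulr1 (bigD1 i)//= (bigD1 j)//= -addrA lerDl.
by rewrite addr_ge0// sumr_ge0// => k _; rewrite sumr_ge0.
Qed.

Lemma exp_boundedD (K : numFieldType) m n (u v : nat -> 'M[K]_(m, n)) :
  exp_bounded u -> exp_bounded v -> exp_bounded (fun x => u x + v x).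
Proof.
move=> [C [c [C0 c0 ub]]] [D [d [D0 d0 vb]]].
exists (C + D), (c + d); split=> [||x i j]; rewrite ?addr_ge0//.
rewrite mxE (le_trans (ler_normD _ _))// mulrDl lerD//.
  apply: le_trans (ub _ _ _) _; rewrite ler_wpM2l// lerXn2r ?nnegrE ?addr_ge0//.
  by rewrite lerDl.
apply: le_trans (vb _ _ _) _; rewrite ler_wpM2l// lerXn2r ?nnegrE ?addr_ge0//.
by rewrite lerDr.
Qed.

(** Growth rates multiply; the factor n accounts for the n summands of an entry
    of the product. *)
Lemma exp_boundedM (K : numFieldType) m n p (u : nat -> 'M[K]_(m, n))
    (v : nat -> 'M[K]_(n, p)) :
  exp_bounded u -> exp_bounded v -> exp_bounded (fun x => u x *m v x).
Proof.
move=> [C [c [C0 c0 ub]]] [D [d [D0 d0 vb]]].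
exists (n%:R * (C * D)), (c * d); split=> [||x i j].
- by rewrite !mulr_ge0.
- by rewrite mulr_ge0.
rewrite mxE (le_trans (ler_norm_sum _ _ _))//.
apply: (@le_trans _ _ (\sum_(k < n) (C * D) * (c * d) ^+ x)).
  by apply: ler_sum => k _; rewrite normrM exprMn mulrACA ler_pM.
by rewrite sumr_const card_ord -[leLHS]mulr_natl -[leRHS]mulrA.
Qed.

Lemma exp_bounded_ctmx (K : numClosedFieldType) m n (u : nat -> 'M[K]_(m, n)) :
  exp_bounded u -> exp_bounded (fun x => (u x) ^t*).
Proof.
move=> [C [c [C0 c0 ub]]]; exists C, c; split=> // x i j.
by rewrite !mxE norm_conjC.
Qed.

Lemma exp_bounded_exp (K : numFieldType) N (B : 'M[K]_N.+1) :
  exp_bounded (fun x => B ^+ x).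
Proof.
(* The sum of the norms of all entries bounds the norm sum of each row. *)
exists 1, (\sum_i \sum_j `|B i j|).
have row_ge0 i : 0 <= \sum_j `|B i j| by apply: sumr_ge0.
split=> // [|x i j]; first by apply: sumr_ge0.
rewrite mul1r; elim: x i j => [|x IHx] i j.
  by rewrite expr0 !mxE; case: (_ == _); rewrite /= ?normr1 ?normr0.
rewrite exprS mxE (le_trans (ler_norm_sum _ _ _))// exprS.
apply: (@le_trans _ _ (\sum_k `|B i k| * (\sum_i \sum_j `|B i j|) ^+ x)).
  by apply: ler_sum => k _; rewrite normrM ler_wpM2l.
rewrite -mulr_suml ler_wpM2r ?exprn_ge0 ?sumr_ge0//.
by rewrite [leRHS](bigD1 i)//= lerDl sumr_ge0.
Qed.

Lemma exp_bounded_nat (K : numFieldType) N :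
  exp_bounded (fun x => x%:R : 'M[K]_N.+1).
Proof.
exists 1, 2; split=> // x i j; rewrite mul1r.
have le_x2x : x%:R <= 2 ^+ x :> K by rewrite -natrX ler_nat ltnW// ltn_expl.
rewrite -[x%:R]scaler_nat !mxE; case: (_ == _); rewrite ?mulr1 ?mulr0 ?normr_nat//.
by rewrite normr0 exprn_ge0.
Qed.

Lemma exp_bounded_horner (K : numFieldType) N (Q : {poly 'M[K]_N.+1}) :
  exp_bounded (fun x => Q.[x%:R]).
Proof.
elim/poly_ind: Q => [|Q B IHQ].
  by under eq_fun do rewrite horner0; exact: exp_bounded_cst.
under eq_fun do rewrite hornerMXaddC.
apply: exp_boundedD; last exact: exp_bounded_cst.
by apply: exp_boundedM => //; exact: exp_bounded_nat.
Qed.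

(** * Convergence of series of complex matrices *)

Lemma cvg_mxP (K : numFieldType) m n (u : nat -> 'M[K]_(m, n)) (L : 'M[K]_(m, n)) :
  (u x @[x --> \oo] --> L) <->
  forall i j, (u x i j @[x --> \oo] --> L i j).
Proof.
split=> [uL i j|uL].
  exact: cvg_comp uL (@coord_continuous K m n i j L).
apply/cvg_ballP => e e0.
have nearL : \forall x \near \oo, forall i j, ball (L i j) e (u x i j).
  apply: filter_forall => i; apply: filter_forall => j.
  by have /cvg_ballP := uL i j; exact.
by apply: filterS nearL => x xL; split.
Qed.

Lemma cvg_sumr (K : numFieldType) (I : Type) (s : seq I) (f : I -> nat -> K)
    (l : I -> K) :
  (forall i, (f i x @[x --> \oo] --> l i)) ->
  ((\sum_(i <- s) f i x) @[x --> \oo] --> \sum_(i <- s) l i).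
Proof.
move=> fl; elim: s => [|i s IHs].
  by under eq_fun do rewrite big_nil; rewrite big_nil; exact: cvg_cst.
under eq_fun do rewrite big_cons; rewrite big_cons.
exact: cvgD (fl i) IHs.
Qed.

Lemma cvg_mulmxl (K : numFieldType) m n p (C : 'M[K]_(m, n))
    (u : nat -> 'M[K]_(n, p)) L :
  (u x @[x --> \oo] --> L) -> (C *m u x @[x --> \oo] --> C *m L).
Proof.
move=> /cvg_mxP uL; apply/cvg_mxP => i j.
under eq_fun do rewrite mxE; rewrite mxE.
by apply: cvg_sumr => k; apply: cvgMl_tmp; exact: uL.
Qed.

Lemma cvg_ctmx (K : numClosedFieldType) m n (u : nat -> 'M[K]_(m, n)) L :
  (u x @[x --> \oo] --> L) -> ((u x) ^t* @[x --> \oo] --> L ^t*).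
Proof.
move=> /cvg_mxP uL; apply/cvg_mxP => i j.
under eq_fun do rewrite !mxE; rewrite !mxE.
apply/cvgrPdist_lt => e e0; have /cvgrPdist_lt/(_ _ e0) := uL j i.
by apply: filterS => x; rewrite -rmorphB norm_conjC.
Qed.

Lemma normc_ge_Im (R : rcfType) (x : R[i]) : (`|complex.Im x|)%:C <= `|x|.
Proof. by rewrite normc_def lecR -sqrtr_sqr ler_wsqrtr// lerDr sqr_ge0. Qed.

Lemma normc_le_ReIm (R : rcfType) (x : R[i]) :
  `|x| <= (`|complex.Re x| + `|complex.Im x|)%:C.
Proof.
rewrite normc_def lecR -[leRHS]ger0_norm ?addr_ge0// -[leRHS]sqrtr_sqr ler_wsqrtr//.
rewrite sqrrD !real_normK ?num_real//= addrAC lerDl mulrn_wge0// mulr_ge0//.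
Qed.

(** Comparison with a real series, applied to the real and imaginary parts.
    The conclusion is spelled out with inequalities because the norm topology
    is attached to abstract fields and not to the type R[i] itself. *)
Lemma complex_series_cvg (R : realType) (z : nat -> R[i]) (v : nat -> R) :
  (forall x, `|z x| <= (v x)%:C) -> cvgn (series v) ->
  exists l : R[i], forall e : R[i], 0 < e ->
    (\forall n \near \oo, `|l - series z n| < e).
Proof.
move=> zv cv.
have v_ge0 x : 0 <= v x.
  by rewrite -(@ler0c R); apply: le_trans (zv x).
have part_cvg (f : R[i] -> R) :
    (forall w, (`|f w|)%:C <= `|w|) -> cvgn (series (f \o z)).
  move=> fle; apply: (@normed_cvg R R^o); apply: series_le_cvg cv => //= x.
  by rewrite -lecR (le_trans (fle _)).
have /cvg_ex[/= p zp] := part_cvg _ (@normc_ge_Re R).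
have /cvg_ex[/= q zq] := part_cvg _ (@normc_ge_Im R).
exists (p +i* q) => e e0.
have eE : e = (complex.Re e)%:C by rewrite RRe_real// gtr0_real.
have e20 : 0 < complex.Re e / 2 by rewrite divr_gt0// -ltcR -eE.
move/cvgrPdist_lt : zp => /(_ _ e20) zp; move/cvgrPdist_lt : zq => /(_ _ e20) zq.
near=> n.
have ReE : complex.Re (series z n) = series (@complex.Re R \o z) n by rewrite raddf_sum.
have ImE : complex.Im (series z n) = series (@complex.Im R \o z) n by rewrite raddf_sum.
apply: le_lt_trans (normc_le_ReIm _) _.
rewrite eE ltcR [complex.Re e]splitr !raddfB /= ReE ImE.
by rewrite ltrD//; near: n; [exact: zp|exact: zq].
Unshelve. all: by end_near. Qed.

(** Named over an abstract field so that it can be stated for complex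
    matrices, for the same reason as in [complex_series_cvg]. *)
Definition mx_summable (K : numClosedFieldType) m n (f : nat -> 'M[K]_(m, n)) : Prop :=
  cvgn (series f).

Lemma mx_summable_entries (K : numClosedFieldType) m n (f : nat -> 'M[K]_(m, n)) :
  (forall i j, exists l, forall e, 0 < e ->
     \forall k \near \oo, `|l - series (fun x => f x i j) k| < e) ->
  mx_summable f.
Proof.
move=> fl.
have /choice[l lP] (ij : 'I_m * 'I_n) : exists l, forall e, 0 < e ->
   \forall k \near \oo, `|l - series (fun x => f x ij.1 ij.2) k| < e by exact: fl.
apply/cvg_ex; exists (\matrix_(i, j) l (i, j)); apply/cvg_mxP => i j.
apply/cvgrPdist_lt => e /(lP (i, j)); apply: filterS => k.
by rewrite mxE /series /= summxE.
Qed.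

(** The entries are dominated by C (a c)^x / x!, whose sum is a multiple of
    exp (a c). *)
Lemma charlier_summable (R : realType) m n (a : R) (g : nat -> 'M[R[i]]_(m, n)) :
  0 <= a -> exp_bounded g ->
  mx_summable (fun x => (a ^+ x / x`!%:R)%:C *: g x).
Proof.
move=> a0 [C [c [C0 c0 gb]]]; apply: mx_summable_entries => i j.
have CE : C = (complex.Re C)%:C by rewrite RRe_real// ger0_real.
have cE : c = (complex.Re c)%:C by rewrite RRe_real// ger0_real.
have w0 x : 0 <= a ^+ x / x`!%:R by rewrite divr_ge0// exprn_ge0.
pose v x := complex.Re C * exp_coeff (a * complex.Re c) x.
pose z x := ((a ^+ x / x`!%:R)%:C *: g x) i j.
have zv x : `|z x| <= (v x)%:C.
  rewrite /z mxE normrM ger0_norm ?ler0c//.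
  apply: le_trans (ler_wpM2l _ (gb x i j)) _; first by rewrite ler0c.
  rewrite CE cE -rmorphXn -!rmorphM lecR /v /exp_coeff /=.
  by rewrite exprMn mulrCA [in leRHS]mulrAC.
have cv : cvgn (series v).
  exact: (@is_cvg_seriesZ R _ (complex.Re C) (is_cvg_series_exp_coeff _)).
by have [l lP] := complex_series_cvg zv cv; exists l => e e0; exact: lP.
Qed.

Lemma lim_mxD (K : numClosedFieldType) m n (f g : nat -> 'M[K]_(m, n)) :
  mx_summable f -> mx_summable g ->
  limn (series (fun x => f x + g x)) = limn (series f) + limn (series g).
Proof.
by move=> cf cg; apply: cvg_lim => //; rewrite [series _]seriesD; exact: cvgD cf cg.
Qed.

Lemma lim_mxM (K : numClosedFieldType) N (C : 'M[K]_N.+1) (f : nat -> 'M[K]_N.+1) :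
  mx_summable f -> limn (series (fun x => C * f x)) = C * limn (series f).
Proof.
move=> cf; apply: cvg_lim => //.
have -> : series (fun x => C * f x) = fun x => C * series f x.
  by apply/funext => x; rewrite /series /= mulr_sumr.
exact: cvg_mulmxl cf.
Qed.

Lemma lim_mxZ (K : numClosedFieldType) m n (a : K) (f : nat -> 'M[K]_(m, n)) :
  mx_summable f -> limn (series (fun x => a *: f x)) = a *: limn (series f).
Proof.
by move=> cf; apply: cvg_lim => //; rewrite [series _]seriesZ; exact: cvgZl_tmp cf.
Qed.

Lemma lim_ctmx (K : numClosedFieldType) m n (f : nat -> 'M[K]_(m, n)) :
  mx_summable f -> limn (series (fun x => (f x) ^t*)) = (limn (series f)) ^t*.
Proof.
move=> cf; apply: cvg_lim => //.
have -> : series (fun x => (f x) ^t*) = fun x => (series f x) ^t*.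
  by apply/funext => x; rewrite /series /= !raddf_sum.
exact: cvg_ctmx cf.
Qed.

Lemma lim_seriesS (K : numClosedFieldType) m n (f : nat -> 'M[K]_(m, n)) :
  mx_summable f -> f 0%N = 0 -> limn (series (fun x => f x.+1)) = limn (series f).
Proof.
move=> cf f0; apply: cvg_lim => //.
have -> : series (fun x => f x.+1) = [sequence series f x.+1]_x.
  by apply/funext => x; rewrite /series /= [RHS]big_nat_recl// f0 add0r.
by rewrite cvg_shiftS; exact: cf.
Qed.

(** * The inner product of the Charlier-type weight *)

(** The ladder identity is the recursion (x + 1) W(x + 1) = a A W(x) A^* of the
    weight after reindexing: the term of <P, U Q> at 0 vanishes because U Q
    has a factor x, and its term at x + 1 is a times the term of <T P, Q> at x. *)
Lemma mxip_ladder_form (K : numClosedFieldType) N (A : 'M[K]_N.+1) (a : K)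
    (w : nat -> K) (W : nat -> 'M[K]_N.+1) :
  A \is a GRing.unit -> (W 0%N) ^t* = W 0%N ->
  (forall x, (w x)^* = w x) -> (forall x, x.+1%:R * w x.+1 = a * w x) ->
  (forall x, W x = w x *: (A ^+ x * W 0%N * (A ^t*) ^+ x)) ->
  (forall P Q : {poly 'M[K]_N.+1},
     mx_summable (fun x => P.[x%:R] * W x * Q.[x%:R] ^t*)) ->
  ladder_form A a (mxip W).
Proof.
move=> A_unit W0_herm w_real w_rec W_def W_sum.
have W_herm x : (W x) ^t* = W x.
  by rewrite W_def ctmxZ !ctmxM W0_herm !ctmxX trmxCK w_real mulrA.
have W_rec x : x.+1%:R *: W x.+1 = a *: (A * W x * A ^t*).
  rewrite (W_def x.+1) (W_def x) -scalerAr -scalerAl !scalerA w_rec exprS exprSr.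
  by rewrite !mulrA.
split.
- move=> P1 P2 Q; rewrite -(lim_mxD (W_sum P1 Q) (W_sum P2 Q)).
  rewrite /mxip; congr (limn (series _)); apply/funext => x.
  by rewrite hornerD !mulrDl.
- move=> C P Q; rewrite -(lim_mxM C (W_sum P Q)).
  rewrite /mxip; congr (limn (series _)); apply/funext => x.
  by rewrite mul_polyC hornerZ !mulrA.
- move=> P Q; rewrite -(lim_ctmx (W_sum P Q)).
  rewrite /mxip; congr (limn (series _)); apply/funext => x.
  by rewrite !ctmxM trmxCK W_herm mulrA.
- move=> P1 P2 Q eqP; rewrite /mxip; congr (limn (series _)).
  by apply/funext => x; rewrite eqP.
- move=> P Q; rewrite -(lim_mxZ _ (W_sum _ _)).
  rewrite /mxip -(lim_seriesS (W_sum _ _)); last first.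
    rewrite horner_raise ?mulr0 ?raddf0 ?mulr0//. by apply/commr_sym/commr0.
  congr (limn (series _)); apply/funext => x.
  rewrite horner_raise ?horner_lower; try exact: nat_comm.
  rewrite -[x.+1%:R]natr1 addrK natr1 mulr_natr !raddfMn mulrnAr -scaler_nat.
  rewrite scalerAl scalerAr W_rec -scalerAr -scalerAl /= !ctmxM ctmxV !mulrA.
  have At_unit : A ^t* \is a GRing.unit by rewrite ctmx_unit.
  by rewrite (mulrK At_unit).
Qed.

Lemma charlier_ladder_form (R : realType) N (a : R) (A : 'M[R[i]]_N.+1)
    (W : nat -> 'M[R[i]]_N.+1) :
  0 <= a -> A \in unitmx -> (W 0%N) ^t* = W 0%N ->
  (forall x : nat,
     W x = (a ^+ x / x`!%:R)%:C *: (A ^+ x * W 0%N * (A ^t*) ^+ x)) ->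
  ladder_form A a%:C (mxip W).
Proof.
move=> a0 A_unit W0_herm W_def.
apply: (mxip_ladder_form A_unit W0_herm _ _ W_def).
- move=> x; apply/conj_Creal/ger0_real; rewrite ler0c.
  by rewrite divr_ge0// exprn_ge0.
- move=> x; rewrite -(rmorph_nat (real_complex R)) -!rmorphM /=; congr _%:C.
  rewrite exprS factS natrM invfM.
  by rewrite -!mulrA mulrCA [x.+1%:R * _]mulrCA mulVKf// pnatr_eq0.
- move=> P Q.
  have -> : (fun x => P.[x%:R] * W x * Q.[x%:R] ^t*) = fun x =>
    (a ^+ x / x`!%:R)%:C *:
      (P.[x%:R] * (A ^+ x * W 0%N * (A ^t*) ^+ x) * Q.[x%:R] ^t*).
    by apply/funext => x; rewrite W_def -scalerAr -scalerAl.
  apply: charlier_summable => //.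
  apply: exp_boundedM; last exact/exp_bounded_ctmx/exp_bounded_horner.
  apply: exp_boundedM; first exact: exp_bounded_horner.
  apply: exp_boundedM; last exact: exp_bounded_exp.
  by apply: exp_boundedM; [exact: exp_bounded_exp|exact: exp_bounded_cst].
Qed.

Theorem theorem4p7 (R : realType) (N : nat) (a : R) (A : 'M[R[i]]_N.+1)
    (W : nat -> 'M[R[i]]_N.+1)
    (P : nat -> {poly 'M[R[i]]_N.+1}) (H : nat -> 'M[R[i]]_N.+1)
    (a_gt0 : 0 < a) (A_unit : A \in unitmx) (W0_posdef : posdefmx (W 0%N))
    (W_def : forall x : nat,
       W x = (a ^+ x / x`!%:R)%:C *: (A ^+ x * W 0%N * (A ^t*) ^+ x))
    (P_orth : monic_orthogonal W P H) :
  (forall n : nat, (2 <= n)%N ->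
     H n = (a ^+ 2)%:C *: (A ^+ 2 * H (n - 1)%N * (A ^t*) ^+ 2)
         - (a ^+ 2)%:C *: (A * H (n - 1)%N * A ^t* * (H (n - 1)%N)^-1
                           * A * H (n - 1)%N * A ^t*)
         + a%:C *: (A * H (n - 1)%N * A ^t*)
         + A * H (n - 1)%N * (A ^t*)^-1 * (H (n - 2)%N)^-1
             * A^-1 * H (n - 1)%N * A ^t*)
  /\ H 1%N = (a ^+ 2)%:C *: (A ^+ 2 * H 0%N * (A ^t*) ^+ 2)
           - (a ^+ 2)%:C *: (A * H 0%N * A ^t* * (H 0%N)^-1
                             * A * H 0%N * A ^t*)
           + a%:C *: (A * H 0%N * A ^t*).
Proof.
have a_neq0 : a%:C != 0 by rewrite fmorph_eq0 gt_eqF.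
have a_real : (a%:C)^* = a%:C by apply/conj_Creal/ger0_real; rewrite ler0c ltW.
have ladder := charlier_ladder_form (ltW a_gt0) A_unit (posdefmx_ctmx W0_posdef) W_def.
have [P_monic P_orthE H_pos] := P_orth.
have orth : orthogonal_family (mxip W) P H.
  split=> [n|n|||n]; [exact: (P_monic n).1|exact: (P_monic n).2|exact: P_orthE| |].
    by move=> n; exact: posdefmx_unit.
  exact: posdefmx_ctmx.
have normS := normS_recursion A_unit a_real ladder orth.
split=> [[|[|n]]// _|]; rewrite normS ?subn1 ?subn2 /= rmorphXn !expr2.
  rewrite (norm_lowerS a_neq0 a_real ladder orth) mulrDr mulrDl scalerDr.
  rewrite -!scalerAr -!scalerAl scalerA -[a%:C * _]expr2 -exprMn mulfV//.
  rewrite expr1n scale1r !mulrA.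
  by rewrite -!addrA; congr (_ + _); rewrite addrC -!addrA.
by rewrite (norm_lower0 ladder orth) !mulrA.
Qed.
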